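(* Let $G=(V,E)$ be a loop directed graph with vertex set $V=\{1,\dots,n\}$ and let $S=\{v_1,\dots,v_m\}\subseteq V$ with $m\le n$. Then the system $(\mathbf{A},\mathbf{B}(S))$ is strongly $S$-controllable, i.e. for every $A\in\mathcal{Q}_{ld}(G)$ and every $B\in\mathbf{B}(S)$ the matrix $[B\ AB\ A^2B\ \cdots\ A^{n-1}B]$ has rank $n$, if and only if (i) $S$ is a zero forcing set of $G$, and (ii) $S$ is a zero forcing set of $G_\times$ for which there exists a chronological list of forces containing no force of the form $i\to i$ with $i\in V_{loop}$.
   Context: A loop directed graph is a finite directed graph in which loops are allowed. $\mathcal{Q}_{ld}(G)$ is the set of real $n\times n$ matrices $A$ with $a_{ij}\neq 0$ iff $(j,i)\in E$ (for all $i,j$, including $i=j$). $\mathbf{B}(S)$ is the set of real $n\times m$ matrices $B$ with $B_{ij}\neq 0$ iff $i=v_j$. $G_\times$ is the graph obtained from $G$ by adding a loop at every vertex, and $V_{loop}$ is the set of vertices having a loop in $G$. Color change rule in a loop directed graph: each vertex is black or white; if exactly one out-neighbor $j$ of vertex $i$ is white (possibly $j=i$; $i$ need not be black), then $j$ is turned black, and we say $i$ forces $j$, written $i\to j$. A zero forcing set is a set $S$ such that starting with exactly $S$ black and applying the rule repeatedly, all vertices become black; a chronological list of forces is a list of the forces in the order in which they are performed to turn all vertices black. *)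

(* Defs.v *)
From HB Require Import structures.
From mathcomp Require Import all_boot all_order all_algebra.
From mathcomp Require Import reals.

Set Implicit Arguments.
Unset Strict Implicit.
Unset Printing Implicit Defensive.

Import GRing.Theory Num.Theory.
Local Open Scope ring_scope.

(* A loop directed graph is given by its set of arcs; (i, j) is the arc from
   i to j, and (i, i) is a loop. *)
Definition loop_digraph (n : nat) : Type := {set 'I_n * 'I_n}.

Definition loop_vertices n (G : loop_digraph n) : {set 'I_n} :=
  [set i | (i, i) \in G].

Definition add_loops n (G : loop_digraph n) : loop_digraph n :=
  G :|: [set (i, i) | i : 'I_n].

Definition out_neighbors n (G : loop_digraph n) (i : 'I_n) : {set 'I_n} :=
  [set j | (i, j) \in G].

(* X is the set of black vertices; i itself may be white. *)
Definition forces n (G : loop_digraph n) (X : {set 'I_n}) (i j : 'I_n) : bool :=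
  out_neighbors G i :\: X == [set j].

(* The pair (i, j) in the list stands for the force i -> j; forces are
   performed one at a time, from the head of the list. *)
Fixpoint chronological_list n (G : loop_digraph n) (X : {set 'I_n})
    (l : seq ('I_n * 'I_n)) : bool :=
  if l is (i, j) :: l' then forces G X i j && chronological_list G (j |: X) l'
  else X == [set: 'I_n].

Definition zero_forcing_set n (G : loop_digraph n) (S : {set 'I_n}) : Prop :=
  exists l : seq ('I_n * 'I_n), chronological_list G S l.

(* Row i, column j of A corresponds to the arc from j to i. *)
Definition Qld (R : realType) n (G : loop_digraph n) (A : 'M[R]_n) : Prop :=
  forall i j : 'I_n, (A i j != 0) = ((j, i) \in G).

(* The set S = {v_1, ..., v_m} is given through its enumeration v, which fixes
   the order of the columns of B. *)
Definition input_pattern (R : realType) n m (v : 'I_m -> 'I_n)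
    (B : 'M[R]_(n, m)) : Prop :=
  forall (i : 'I_n) (j : 'I_m), (B i j != 0) = (i == v j).

Definition controllability_mx (R : realType) n m (A : 'M[R]_n)
    (B : 'M[R]_(n, m)) : 'M[R]_(n, \sum_(k < n) m) :=
  \mxrow_(k < n) (A ^+ k *m B).

Definition strongly_controllable (R : realType) n m (G : loop_digraph n)
    (v : 'I_m -> 'I_n) : Prop :=
  forall (A : 'M[R]_n) (B : 'M[R]_(n, m)),
    Qld G A -> input_pattern v B -> \rank (controllability_mx A B) = n.

(* Main.v *)
Require Import Defs.
From HB Require Import structures.
From mathcomp Require Import all_boot all_order all_algebra.
From mathcomp Require Import reals complex.

(* By the Hautus test over the complex numbers, controllability of (A, B) fails
   iff some nonzero row vector w has w A = a w and w B = 0.  The second equation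
   says that w vanishes on S.  A force i -> j, read in column i of
   w (A - a I) = 0, then gives w_j = 0 once w vanishes on the black
   vertices: the graph G handles a = 0 and the graph with all loops
   added handles a <> 0, where a loop of G must not force itself because
   A_ii - a may vanish.  Conversely, if forcing gets stuck with white set W, the
   indicator vector of W is a left eigenvector, with eigenvalue 0 for (i) and 1
   for (ii), of a suitable real matrix with the pattern of G. *)

Set Implicit Arguments.
Unset Strict Implicit.
Unset Printing Implicit Defensive.

Import GRing.Theory Num.Theory.
Local Open Scope ring_scope.

(** * Left eigenvectors and the kernel of the controllability matrix *)

Lemma prod_annihilated_eigenvector (F : fieldType) (n m d : nat)
    (A : 'M[F]_n) (B : 'M[F]_(n, m)) (s : seq F) (x : 'rV[F]_n) :
    x != 0 -> (size s <= d)%N ->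
    (forall k, (k < d)%N -> x *m (A ^+ k *m B) = 0) ->
    x *m \prod_(z <- s) (A - z%:M) = 0 ->
  exists a, exists2 w : 'rV[F]_n, w != 0 & w *m A = a *: w /\ w *m B = 0.
Proof.
elim: s d x => [|z s IHs] d x x0 ltsd xB.
  by rewrite big_nil mulmx1 => xE; rewrite xE eqxx in x0.
case: d ltsd xB => // d ltsd xB; rewrite big_cons -mulmxE mulmxA => xs0.
have [y0|y0] := eqVneq (x *m (A - z%:M)) 0.
  exists z, x => //; split.
    by apply/eqP; rewrite -subr_eq0 -mul_mx_scalar -mulmxBr y0.
  by have:= xB 0%N isT; rewrite expr0 mul1mx.
(* Passing to [x *m (A - z%:M)] uses up one power of [A], so [d] drops by one together with the
   length of [s]. *)
apply: IHs y0 ltsd _ xs0 => k ltkd.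
rewrite mulmxBr mulmxBl mul_mx_scalar -scalemxAl [X in _ - _ *: X]xB; last first.
  exact: leqW.
rewrite scaler0 subr0 -mulmxA [A *m _]mulmxA mulmxE -exprS; exact: xB.
Qed.

(* Over the factored characteristic polynomial prod (X - z_i), multiply x by
   the factors A - z_i one at a time: the last nonzero vector is a left
   eigenvector, of the form x q(A) with deg q < n. *)
Lemma uncontrollable_eigenvector (F : closedFieldType) (n m : nat)
    (A : 'M[F]_n) (B : 'M[F]_(n, m)) (x : 'rV[F]_n) :
    x != 0 -> (forall k, (k < n)%N -> x *m (A ^+ k *m B) = 0) ->
  exists a, exists2 w : 'rV[F]_n, w != 0 & w *m A = a *: w /\ w *m B = 0.
Proof.
case: n A B x => [|n] A B x x0 xB; first by rewrite thinmx0 eqxx in x0.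
have [s charE] := closed_field_poly_normal (char_poly A).
rewrite (monicP (char_poly_monic A)) scale1r in charE.
apply: (prod_annihilated_eigenvector (s := s) x0 _ xB).
  by have:= size_char_poly A; rewrite charE size_prod_XsubC => -[->].
have := Cayley_Hamilton A; rewrite charE rmorph_prod /=.
under eq_bigr do rewrite rmorphB /= horner_mx_X horner_mx_C.
by move=> ->; rewrite mulmx0.
Qed.

Lemma controllability_kernelP (R : realType) n m (A : 'M[R]_n)
    (B : 'M[R]_(n, m)) :
  (\rank (controllability_mx A B) = n) <->
  (forall x : 'rV[R]_n,
     (forall k, (k < n)%N -> x *m (A ^+ k *m B) = 0) -> x = 0).
Proof.
have mulE (x : 'rV[R]_n) : x *m controllability_mx A B = 0 <->
    (forall k, (k < n)%N -> x *m (A ^+ k *m B) = 0).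
  rewrite /controllability_mx mul_mxrow; split=> [xC0 k ltkn|xC0].
    have := congr1 (fun M => submxrow M (Ordinal ltkn)) xC0.
    rewrite mxrowK /= => ->; apply/matrixP=> i j; by rewrite !mxE.
  by rewrite -[RHS](mxrow0 1); apply/eq_mxrowP => k; exact: xC0.
split=> [rkC x /mulE xC0|xP].
  have freeC : row_free (controllability_mx A B) by rewrite /row_free rkC.
  by apply: (row_free_inj freeC); rewrite xC0 mul0mx.
apply/eqP; change (row_free (controllability_mx A B)); rewrite -kermx_eq0.
apply/rowV0P=> x /sub_kermxP xC0; exact/xP/mulE.
Qed.

(** * Forcing processes and left kernels *)

Section Forcing.
Variables (n : nat) (H : loop_digraph n).
Implicit Types (X : {set 'I_n}) (l : seq ('I_n * 'I_n)).

(** Forces allowed by [P] are performed greedily; each blackens a white vertex, so the process ends,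
    either all black or stuck at [Y]. The relation [P] serves to ban self-forces at loops in
    (ii). *)
Lemma forced_list_or_stuck (P : rel 'I_n) X :
  (exists2 l, chronological_list H X l & all (fun e => P e.1 e.2) l) \/
  (exists Y : {set 'I_n}, [/\ X \subset Y, Y != setT &
     forall i j, P i j -> ~~ forces H Y i j]).
Proof.
have [k] := ubnP #|~: X|; elim: k X => // k IHk X leXk.
have [->|XnT] := eqVneq X setT; first by left; exists [::] => //=.
have [/existsP[i /existsP[j /andP[Pij fij]]]|/existsPn nf] :=
  boolP [exists i, exists j, P i j && forces H X i j]; last first.
  right; exists X; split=> // i j Pij; apply/negP=> fij.
  by move/existsPn: (nf i) => /(_ j); rewrite Pij fij.
have jX : j \notin X.
  by have := set11 j; rewrite -(eqP fij) inE => /andP[].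
have [|[l cl Pl]|[Y [XY YT nY]]] := IHk (j |: X).
- rewrite -ltnS (leq_trans _ leXk) // ltnS proper_card // properC.
  by rewrite properUr // sub1set.
- by left; exists ((i, j) :: l); rewrite /= ?fij ?Pij.
- by right; exists Y; split=> //; apply: subset_trans XY; apply: subsetUr.
Qed.

(** When [i] forces [j], column [i] of [x *m M = 0] reduces to the single term [x 0 j * M j i]. Only
    arcs used as forces need a nonzero entry, which leaves room for diagonal entries of A - aI that
    vanish. *)
Lemma forcing_kernel0 (F : fieldType) (M : 'M[F]_n) X l (x : 'rV[F]_n) :
    chronological_list H X l ->
    (forall i j, M j i != 0 -> (i, j) \in H) ->
    (forall i j, (i, j) \in H -> (i, j) \in l -> M j i != 0) ->
    {in X, forall j, x 0 j = 0} -> x *m M = 0 -> x = 0.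
Proof.
move=> + MH + + xM0; elim: l X => [|[i j] l IHl] X /=.
  move=> /eqP-> _ xX; apply/rowP=> j; rewrite xX ?mxE //; exact: in_setT.
case/andP=> /eqP fij cl Ml xX; apply: (IHl _ cl).
  by move=> i' j' ij' ijl; apply: Ml; rewrite // inE ijl orbT.
move=> k /setU1P[-> {k}|]; last exact: xX.
have ijH : (i, j) \in H.
  by have := set11 j; rewrite -fij !inE => /andP[].
have := congr1 (fun N : 'rV_n => N 0 i) xM0; rewrite !mxE (bigD1 j) //=.
rewrite big1 ?addr0 => [/eqP|k kj].
  by rewrite mulf_eq0 (negbTE (Ml _ _ ijH (mem_head _ _))) orbF => /eqP.
have [kX|kX] := boolP (k \in X); first by rewrite xX ?mul0r.
have [->|/MH ikH] := eqVneq (M k i) 0; first by rewrite mulr0.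
have : k \in out_neighbors H i :\: X by rewrite !inE kX.
by rewrite fij inE (negbTE kj).
Qed.

End Forcing.

(** * Necessity: a bad matrix from a stuck black set *)

Lemma sum_prescribed_nonzero (F : numFieldType) (T : finType) (W : {set T})
    (c : F) :
    (#|W| = 0%N -> c = 0) -> (#|W| = 1%N -> c != 0) ->
  exists2 f : T -> F, {in W, forall i, f i != 0} & \sum_(i in W) f i = c.
Proof.
have [->|[i iW]] := set_0Vmem W.
  by move=> c0 _; exists (fun=> 0) => [i|]; rewrite ?inE // big_set0 c0 ?cards0.
move=> _ c1.
pose k := #|W :\ i|; have Wk : #|W| = k.+1 by rewrite (cardsD1 i) iW.
have [c_k|c_k] := eqVneq c k%:R; last first.
  exists (fun j => if j == i then c - k%:R else 1).
    by move=> j _; case: ifP; rewrite ?oner_eq0 ?subr_eq0.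
  rewrite (bigD1 i) //= eqxx (eq_bigr (fun=> 1)) => [|j /andP[_ /negPf->]] //.
  rewrite (eq_bigl (mem (W :\ i))) => [|j]; last by rewrite !inE andbC.
  by rewrite sumr_const subrK.
(* Here 1 off i would force f i = 0; with 2 off i instead, f i = -k. *)
exists (fun j => if j == i then c - 2%:R * k%:R else 2%:R).
  move=> j _; case: ifP => _; last by rewrite pnatr_eq0.
  rewrite c_k mulr_natl mulr2n opprD addrA subrr sub0r oppr_eq0.
  by have [k0|k0] := posnP k; [have := c1; rewrite Wk k0 c_k k0 eqxx => /(_ erefl)
                               | rewrite pnatr_eq0 -lt0n].
rewrite (bigD1 i) //= eqxx (eq_bigr (fun=> 2%:R)) => [|j /andP[_ /negPf->]] //.
rewrite (eq_bigl (mem (W :\ i))) => [|j]; last by rewrite !inE andbC.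
by rewrite sumr_const mulr_natr subrK.
Qed.

Section Necessity.
Variables (R : realType) (n m : nat) (G : loop_digraph n) (v : 'I_m -> 'I_n).
Let S : {set 'I_n} := [set v j | j : 'I_m].

(** The two cardinality hypotheses rule out the only obstructions to choosing nonzero entries with a
    prescribed sum: an empty sum is 0, and a one-term sum is not. *)
Lemma stuck_uncontrollable (Y : {set 'I_n}) (c : R) :
    S \subset Y -> Y != setT ->
    (forall i, #|out_neighbors G i :\: Y| = 0%N -> i \notin Y -> c = 0) ->
    (forall i, #|out_neighbors G i :\: Y| = 1%N -> i \notin Y /\ c != 0) ->
  ~ strongly_controllable R G v.
Proof.
move=> SY YT out0 out1 scG.
(* Column [i] of [x *m A = c *: x], for [x] the indicator of the white vertices, asks that the
   entries in white rows sum to [c] if [i] is white and to 0 otherwise. Finite functions allow the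
   use of [xchoose]. *)
have colP i : exists f : {ffun 'I_n -> R},
    [forall j in out_neighbors G i :\: Y, f j != 0] &&
    (\sum_(j in out_neighbors G i :\: Y) f j == c *+ (i \notin Y)).
  have [||f fN0 fS] := @sum_prescribed_nonzero R _
    (out_neighbors G i :\: Y) (c *+ (i \notin Y)).
  - by move=> /out0; case: (i \notin Y) => // ->.
  - by move=> /out1[-> ].
  exists (finfun f); apply/andP; split.
    by apply/forall_inP=> j /fN0; rewrite ffunE.
  by under eq_bigr do rewrite ffunE; apply/eqP.
pose f i := xchoose (colP i).
pose A : 'M[R]_n := \matrix_(j, i)
  if (i, j) \in G then (if j \in Y then 1 else f i j) else 0.
pose B : 'M[R]_(n, m) := \matrix_(i, j) (i == v j)%:R.
pose x : 'rV[R]_n := \row_i (i \notin Y)%:R.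
have AG : Qld G A.
  move=> j i; rewrite mxE; case: ifP => ij; last by rewrite eqxx.
  case: ifPn => jY; first by rewrite oner_eq0.
  have /andP[/forall_inP/(_ j) fij _] := xchooseP (colP i).
  by rewrite fij // !inE jY.
have Bv : input_pattern v B.
  by move=> i j; rewrite mxE pnatr_eq0 eqb0 negbK.
have xB : x *m B = 0.
  apply/rowP=> j; rewrite !mxE big1 // => i _; rewrite !mxE.
  case: eqP => [->|]; last by rewrite mulr0.
  by rewrite (subsetP SY) ?mul0r // imset_f.
have xA : x *m A = c *: x.
  apply/rowP=> i; have /andP[_ /eqP fS] := xchooseP (colP i).
  rewrite !mxE mulr_natr -fS [RHS]big_mkcond; apply: eq_bigr => j _.
  rewrite !mxE !inE; case: (j \in Y); rewrite /= ?mul0r // mul1r.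
  by case: ifP.
have /controllability_kernelP/(_ x) x0 := scG A B AG Bv.
case/negP: YT; apply/eqP/setP=> i; rewrite inE.
have xAk k : x *m A ^+ k = c ^+ k *: x.
  elim: k => [|k IHk]; first by rewrite !expr0 mulmx1 scale1r.
  by rewrite exprS -mulmxE mulmxA xA -scalemxAl IHk scalerA -exprS.
have : x = 0 by apply: x0 => k _; rewrite mulmxA xAk -scalemxAl xB scaler0.
move/rowP/(_ i); rewrite !mxE; case: (i \in Y) => // /eqP.
by rewrite oner_eq0.
Qed.

End Necessity.

(** * Sufficiency, and the equivalence *)

Lemma forcing_controllable (R : realType) (n m : nat) (G : loop_digraph n)
    (v : 'I_m -> 'I_n) (l l' : seq ('I_n * 'I_n)) :
    chronological_list G [set v j | j : 'I_m] l ->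
    chronological_list (add_loops G) [set v j | j : 'I_m] l' ->
    (forall i, i \in loop_vertices G -> (i, i) \notin l') ->
  strongly_controllable R G v.
Proof.
move=> cl cl' noloop A B AG Bv; apply/controllability_kernelP=> x xAB.
apply/eqP; apply/negPn/negP => x0.
(* The eigenvalue need not be real; the embedding into [R[i]] keeps the zero pattern. *)
pose f : {rmorphism R -> R[i]} := real_complex R.
have [||a [w w0 [wA wB]]] :=
  @uncontrollable_eigenvector R[i] n m (map_mx f A) (map_mx f B)
    (map_mx f x).
- by rewrite map_mx_eq0.
- move=> k /xAB; rewrite -rmorphXn -!map_mxM => ->; exact: map_mx0.
have wS : {in [set v j | j : 'I_m], forall j, w 0 j = 0}.
  move=> _ /imsetP[j _ ->].
  have := congr1 (fun N : 'rV_m => N 0 j) wB; rewrite !mxE (bigD1 (v j)) //=.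
  rewrite big1 ?addr0 => [/eqP|k /negPf kj].
    rewrite mulf_eq0 mxE fmorph_eq0 (negbTE (_ : B _ _ != 0)) ?Bv // orbF.
    by move/eqP.
  apply/eqP; rewrite mulf_eq0 mxE fmorph_eq0.
  by have := Bv k j; rewrite kj => /negbFE ->; rewrite orbT.
case/negP: w0; apply/eqP.
have [a0|a0] := eqVneq a 0.
  apply: (forcing_kernel0 (M := map_mx f A) cl _ _ wS) => [i j|i j ij _|].
  - by rewrite mxE fmorph_eq0 AG.
  - by rewrite mxE fmorph_eq0 AG.
  - by rewrite wA a0 scale0r.
apply: (forcing_kernel0 (M := map_mx f A - a%:M) cl' _ _ wS) => [i j|i j ij ijl|].
- rewrite !mxE !inE; have [-> _|ji] := eqVneq j i.
    by rewrite imset_f ?orbT.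
  by rewrite subr0 fmorph_eq0 AG => ->.
(* A self-force in [l'] occurs only at a loopless vertex, where the diagonal entry is -a. *)
- rewrite !mxE; have [ji|ji] := eqVneq j i.
    rewrite ji in ijl *.
    have iG : (i, i) \notin G.
      by apply: contraL ijl => iG; apply: noloop; rewrite inE.
    have /eqP-> : A i i == 0 by apply: negbFE; rewrite AG (negbTE iG).
    by rewrite rmorph0 sub0r oppr_eq0.
  rewrite subr0 fmorph_eq0 AG; move: ij; rewrite inE => /orP[] // /imsetP[k _].
  by case=> ik jk; rewrite ik jk eqxx in ji.
- by rewrite mulmxBr wA mul_mx_scalar subrr.
Qed.

Theorem theorem5p5 (R : realType) (n m : nat) (G : loop_digraph n)
    (v : 'I_m -> 'I_n) (v_inj : injective v) (le_mn : (m <= n)%N) :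
  let S : {set 'I_n} := [set v j | j : 'I_m] in
  strongly_controllable R G v <->
  (zero_forcing_set G S /\
   (zero_forcing_set (add_loops G) S /\
    exists l : seq ('I_n * 'I_n),
      chronological_list (add_loops G) S l /\
      (forall i : 'I_n, i \in loop_vertices G -> (i, i) \notin l))).
Proof.
move=> S; split=> [scG|[[l cl] [_ [l' [cl' noloop]]]]]; last first.
  exact: forcing_controllable cl cl' noloop.
split.
  have [[l cl _]|[Y [SY YT stuck]]] :=
    forced_list_or_stuck G (fun _ _ => true) S.
    by exists l.
  exfalso; apply: (@stuck_uncontrollable R n m G v Y 0 SY YT _ _ scG) => // i.
  move=> /eqP/cards1P[j ij].
  by have /negP[] := stuck i j isT; rewrite /forces ij eqxx.
pose P i j := (i == j) ==> (i \notin loop_vertices G).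
have [[l cl Pl]|[Y [SY YT stuck]]] := forced_list_or_stuck (add_loops G) P S.
  split; first by exists l.
  exists l; split=> // i iG; apply/negP=> /(allP Pl).
  by rewrite /P /= eqxx iG.
have outE i : out_neighbors (add_loops G) i = i |: out_neighbors G i.
  apply/setP=> j; rewrite !inE orbC; congr (_ || _).
  apply/imsetP/eqP => [[k _ [-> ->]] //|->]; by exists i.
exfalso; apply: (@stuck_uncontrollable R n m G v Y 1 SY YT _ _ scG) => i.
  move=> /eqP; rewrite cards_eq0 => /eqP out0 iY.
  (* A white [i] without white out-neighbors in [G] has no loop, so it could force itself in
     [add_loops G], and [P] allows this. *)
  have iG : i \notin loop_vertices G.
    apply/negP; rewrite inE => iG.
    by have := in_set0 i; rewrite -out0 !inE iY iG.
  have Pii : P i i by rewrite /P iG implybT.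
  have /negP[] := stuck i i Pii.
  rewrite /forces outE setDUl out0 setU0; apply/eqP/setP=> j.
  by rewrite !inE; case: eqP => [->|]; rewrite ?iY ?andbF.
move=> /eqP/cards1P[j outi]; split; last exact: oner_neq0.
(* If [i] were black, the added loop would give it no new white out-neighbor, and [i] could still
   force [j]. *)
apply/negP=> iY.
have ji : j != i.
  have : j \in out_neighbors G i :\: Y by rewrite outi set11.
  by rewrite !inE => /andP[jY _]; apply: contraNneq jY => ->.
have Pij : P i j by rewrite /P eq_sym (negbTE ji).
have /negP[] := stuck i j Pij.
rewrite /forces outE setDUl outi; apply/eqP/setP=> k.
by rewrite !inE; have [->|_] := eqVneq k i; rewrite ?iY ?andbF.
Qed.
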